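(* Let $X$ be a nonempty ULC metric space, and let $X^\omega$ be the product of countably infinitely many copies of $X$. Then (a) $X^\omega$ is ULC if and only if $X$ is connected; (b) $X^\omega$ is straight if and only if $X$ is either connected or precompact.
   Context: All spaces are metric. A metric space $X$ is straight if whenever $X$ is the union of finitely many closed sets, a continuous function $f\colon X\to\mathbb{R}$ is uniformly continuous if and only if its restriction to each of these closed sets is uniformly continuous. A metric space $X$ is uniformly locally connected (ULC) if for every $\varepsilon>0$ there is $\delta>0$ such that any two points of $X$ at distance $<\delta$ lie in a connected subset of $X$ of diameter $<\varepsilon$. Precompact means totally bounded (equivalently, the metric completion is compact). Metrics are assumed to be bounded by $1$ (only uniform properties matter), and a countably infinite product $\prod_n X_n$ of metric spaces $(X_n,d_n)$ carries the metric $d(x,y)=\sum_n \frac{1}{2^n}d_n(x_n,y_n)$. *)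

(* Defs.v *)
From HB Require Import structures.
From mathcomp Require Import all_boot all_order all_algebra.
From mathcomp Require Import all_classical all_reals all_analysis.
From mathcomp Require Import lra.
Set Implicit Arguments.
Unset Strict Implicit.
Unset Printing Implicit Defensive.
Import Order.TTheory GRing.Theory Num.Theory.
Import numFieldNormedType.Exports.
Local Open Scope classical_set_scope.
Local Open Scope ring_scope.

HB.mixin Record Metric_isBoundedBy1 (K : numDomainType) M of Metric K M := {
  mdist_le1 : forall x y : M, mdist x y <= 1
}.

#[short(type="metric1Type")]
HB.structure Definition Metric1 (K : numDomainType) :=
  { M of Metric K M & Metric_isBoundedBy1 K M }.

(* Countable products. A type alias is used because the library already puts *)
(* the product topology, but no metric, on dependent function types.         *)
Definition countable_prod (R : realType) (X : nat -> metric1Type R) : Type :=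
  forall n, X n.

HB.instance Definition _ (R : realType) (X : nat -> metric1Type R) :=
  gen_eqMixin (countable_prod X).
HB.instance Definition _ (R : realType) (X : nat -> metric1Type R) :=
  gen_choiceMixin (countable_prod X).

Section countable_prod_metric.
Context (R : realType) (X : nat -> metric1Type R).
Implicit Types x y z : countable_prod X.

(* The factors are numbered X_1 = X 0, X_2 = X 1, ..., so X n has weight     *)
(* 1 / 2 ^ (n + 1) and the product distance is again bounded by 1.           *)
Definition countable_prod_dist x y : R :=
  limn (series (fun n => mdist (x n) (y n) / 2 ^+ n.+1)).

Let term_ge0 x y n : 0 <= mdist (x n) (y n) / 2 ^+ n.+1 :> R.
Proof. by rewrite divr_ge0 ?mdist_ge0 ?exprn_ge0. Qed.

Let term_le x y n :
  mdist (x n) (y n) / 2 ^+ n.+1 <= geometric (2^-1) (2^-1) n :> R.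
Proof.
rewrite /geometric /= -exprS -exprVn ler_piMl ?mdist_le1//.
Qed.

Let half_lt1 : `|2^-1 : R| < 1.
Proof. by rewrite ger0_norm ?invr_ge0// invf_lt1 ?ltr1n. Qed.

Lemma is_cvg_countable_prod_dist x y :
  cvgn (series (fun n => mdist (x n) (y n) / 2 ^+ n.+1 : R)).
Proof.
apply: (@series_le_cvg R _ (geometric (2^-1) (2^-1))).
- exact: term_ge0.
- by move=> n; rewrite /geometric /= mulr_ge0 ?exprn_ge0 ?invr_ge0.
- exact: term_le.
- exact: is_cvg_geometric_series.
Qed.

Let dist_le1 x y : countable_prod_dist x y <= 1.
Proof.
have -> : 1 = limn (series (geometric (2^-1) (2^-1) : R^nat)).
  apply/esym/cvg_lim => //.
  have := @cvg_geometric_series R 2^-1 2^-1 half_lt1.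
  by rewrite (_ : 1 - 2^-1 = 2^-1) ?divff ?invr_neq0//; lra.
apply: lim_series_le; last exact: term_le.
- exact: is_cvg_countable_prod_dist.
- exact: is_cvg_geometric_series.
Qed.

Let distxx x : countable_prod_dist x x = 0.
Proof.
rewrite /countable_prod_dist.
under eq_fun do rewrite mdistxx mul0r.
by apply: cvg_lim => //; rewrite /series /=; under eq_fun do rewrite big1//;
  exact: cvg_cst.
Qed.

Let dist_eq0 x y : countable_prod_dist x y = 0 -> x = y.
Proof.
move=> xy0; apply: functional_extensionality_dep => n; apply: mdist_positivity.
have le0 : mdist (x n) (y n) / 2 ^+ n.+1 <= 0 :> R.
  rewrite -xy0; apply: le_trans
    (nondecreasing_cvgn_le _ (@is_cvg_countable_prod_dist x y) n.+1).
    by rewrite /series /= big_nat_recr //= lerDr sumr_ge0.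
  by apply: nondecreasing_series => k _ _; exact: term_ge0.
apply/eqP; rewrite eq_le mdist_ge0 andbT.
by move: le0; rewrite pmulr_lle0 ?invr_gt0 ?exprn_gt0.
Qed.

Let dist_sym x y : countable_prod_dist x y = countable_prod_dist y x.
Proof.
by rewrite /countable_prod_dist; under eq_fun do rewrite metric_sym.
Qed.

Let dist_triangle y x z :
  countable_prod_dist x z <= countable_prod_dist x y + countable_prod_dist y z.
Proof.
have cxy := @is_cvg_countable_prod_dist x y.
have cyz := @is_cvg_countable_prod_dist y z.
rewrite /countable_prod_dist -lim_seriesD//.
apply: lim_series_le; first exact: is_cvg_countable_prod_dist.
  exact: is_cvg_seriesD.
move=> n; rewrite /= -mulrDl ler_pM2r ?invr_gt0 ?exprn_gt0//.
exact: metric_triangle.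
Qed.

HB.instance Definition _ := @isMetric.Build R (countable_prod X)
  countable_prod_dist distxx dist_eq0 dist_sym dist_triangle.

HB.instance Definition _ :=
  @Metric_isBoundedBy1.Build R (countable_prod X) dist_le1.

End countable_prod_metric.

Definition omega_power (R : realType) (X : metric1Type R) : metric1Type R :=
  countable_prod (fun=> X).

Definition diameter (R : realType) (X : metricType R) (A : set X) : \bar R :=
  ereal_sup [set (mdist p.1 p.2)%:E | p in A `*` A].

Definition ULC (R : realType) (X : metricType R) : Prop :=
  forall eps : R, 0 < eps -> exists2 delta : R, 0 < delta &
    forall x y : X, mdist x y < delta ->
      exists A : set X,
        [/\ A x, A y, connected A & (diameter A < eps%:E)%E].

(* [sigL (C i) f] is the restriction of [f] to the subtype of points of [C i], *)
(* which carries the induced uniformity.                                       *)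
Definition straight (R : realType) (X : metricType R) : Prop :=
  forall (n : nat) (C : 'I_n -> set X),
    (forall i, closed (C i)) -> \bigcup_i C i = [set: X] ->
    forall f : X -> R, continuous f ->
      (unif_continuous f <-> forall i, unif_continuous (sigL (C i) f)).

(* The library's [precompact] means relatively compact, hence this notion. *)
Definition totally_bounded (R : realType) (X : metricType R) : Prop :=
  forall eps : R, 0 < eps -> exists2 F : set X, finite_set F &
    [set: X] = \bigcup_(x in F) ball x eps.

(* Main.v *)
Require Import Defs.
From mathcomp Require Import all_boot all_order all_algebra.
From mathcomp Require Import all_classical all_reals all_analysis.
From mathcomp Require Import lra.
Set Implicit Arguments.
Unset Strict Implicit.
Unset Printing Implicit Defensive.
Import Order.TTheory GRing.Theory Num.Theory.
Import numFieldNormedType.Exports.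
Local Open Scope classical_set_scope.
Local Open Scope ring_scope.

(** Two constructions carry the proof: small connected sets in the product,
    which control continuous functions, and one explicit function, which shows
    that straightness fails.

    A product of connected sets is connected in [countable_prod]
    ([connected_box]), and its diameter is governed by finitely many factors.
    Hence, when X is ULC, two points x and y of the power lie in a small
    connected set as soon as x_n and y_n share a component of X for every n and
    are close for the first few n ([omega_small_connected]). If X is connected,
    the condition on components is void and the power is ULC. Conversely, if X
    splits into two separated parts, changing one far coordinate from one part
    to the other moves a point as little as desired, but the two points are
    not in a common connected set, since the projection of such a set to that
    coordinate would be connected.

    For straightness, let f be continuous and uniformly continuous on each of
    the finitely many pieces of a cover. The values of f on a connected set form
    an interval, so a pigeonhole argument bounds the variation of f on small
    connected sets ([small_connected_oscillation]). This gives straightness of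
    every ULC space, hence of the power when X is connected. When X is totally
    bounded, take a finite net F of X with a map r to nearby points of F. Then x
    and (r x_n)_n lie in a small connected set, so f hardly distinguishes them,
    and f is uniformly continuous on the compact set F^omega. For y close to x,
    comparing x with (r x_n)_n, then with
    (r x_0, ..., r x_(N-1), y_N, y_(N+1), ...), then with y bounds |f x - f y|.

    If X is neither connected nor totally bounded, it has a uniformly separated
    sequence (u_n) and a partition into nonempty clopen sets E_0, E_1. Let h be
    a sum of disjoint bumps on X centred at the points u_n. The function equal
    to h(z_0) if z_(n+1) is in E_1 for the index n of the bump containing z_0,
    and to 0 otherwise, is continuous, and uniformly continuous on the two
    closed pieces that define it, but not on the power: for z_0 = u_n it changes
    by a constant when the coordinate n + 1, whose weight tends to 0, crosses
    from E_0 to E_1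
    ([straight_omega_power_connected]). *)

(** * Uniform notions in terms of the distance *)

Section metric_calculus.
Context (R : realType).
Implicit Types X Y : metricType R.

Lemma nbhs_mdist X (x : X) (A : set X) :
  nbhs x A <-> exists2 d : R, 0 < d & forall y, mdist x y < d -> A y.
Proof.
by rewrite -metricType_numDomainType.filter_from_mdist_nbhs.
Qed.

Lemma continuous_mdistP X Y (f : X -> Y) : continuous f <->
  forall x (e : R), 0 < e ->
    exists2 d : R, 0 < d & forall y, mdist x y < d -> mdist (f x) (f y) < e.
Proof.
split=> [cf x e e0|cf x A /nbhs_mdist[e e0 eA]].
  have /cf/nbhs_mdist// : nbhs (f x) [set z | mdist (f x) z < e].
  by apply/nbhs_mdist; exists e.
have [d d0 dP] := cf x e e0.
by apply/nbhs_mdist; exists d => // y /dP /eA.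
Qed.

Lemma unif_continuous_mdistP X (f : X -> R) : unif_continuous f <->
  forall e : R, 0 < e -> exists2 d : R, 0 < d &
    forall x y, mdist x y < d -> `|f x - f y| < e.
Proof.
split=> [/unif_continuousP cf e e0|cf]; last apply/unif_continuousP => e e0.
  have [d d0 dP] := cf e e0; exists d => // x y xy.
  by apply: (dP (x, y)); rewrite /= ballEmdist.
have [d d0 dP] := cf e e0; exists d => // -[x y] /=.
by rewrite ballEmdist => /dP.
Qed.

Lemma unif_continuous_sigL_mdistP X (C : set X) (f : X -> R) :
  unif_continuous (sigL C f) <->
  forall e : R, 0 < e -> exists2 d : R, 0 < d &
    forall x y, C x -> C y -> mdist x y < d -> `|f x - f y| < e.
Proof.
split=> [/unif_continuousP cf e e0|cf]; last apply/unif_continuousP => e e0.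
  have [d d0 dP] := cf e e0; exists d => // x y Cx Cy xy.
  apply: (dP (SigSub (mem_set Cx), SigSub (mem_set Cy))).
  by rewrite -initial_ballE/= ballEmdist.
have [d d0 dP] := cf e e0; exists d => // -[x y].
rewrite -initial_ballE/= ballEmdist/= => xy.
by apply: dP => //; exact/set_mem/valP.
Qed.

Lemma diameter_lt_mdist X (A : set X) (e : R) x y :
  (diameter A < e%:E)%E -> A x -> A y -> mdist x y < e.
Proof.
move=> Ae Ax Ay; rewrite -lte_fin; apply: le_lt_trans Ae.
by apply: ereal_sup_ubound; exists (x, y).
Qed.

Lemma mdist_le_diameter X (A : set X) (e : R) :
  (forall x y, A x -> A y -> mdist x y <= e) -> (diameter A <= e%:E)%E.
Proof.
move=> Ae; apply: ge_ereal_sup => _ [[x y] /= [Ax Ay] <-].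
by rewrite lee_fin Ae.
Qed.

End metric_calculus.

(** * Continuous functions on connected sets *)

(** A separation of B leaves A on one side, and the closure of that side misses
    the other. *)
Lemma connected_dense (T : topologicalType) (A B : set T) :
  connected A -> A `<=` B -> B `<=` closure A -> connected B.
Proof.
move=> cA AB BA; apply/connectedP => E [E0 BE sE].
wlog AE : E E0 BE sE / A `<=` E false.
  move=> G; have [||] := connected_subset sE _ cA; first by rewrite -BE.
    exact: G.
  move=> AE; apply: (G (E \o negb)) => //.
  - by move=> b; exact: E0.
  - by rewrite /= setUC.
  - by rewrite /= separatedC.
have [y Ey] := E0 true; case: sE => + _; apply/eqP/set0P; exists y; split=> //.
by apply: (closureS AE); apply: BA; rewrite BE; right.
Qed.

(** The image of A is an interval. If it were longer than n e, it would contain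
    n + 1 values spaced by e, and two of them would come from the same piece. *)
Lemma pieces_variation (R : realType) (T : topologicalType) (A : set T)
    (f : T -> R) n (C : 'I_n -> set T) (e : R) :
  connected A -> continuous f -> A `<=` \bigcup_i C i ->
  (forall i x y, A x -> A y -> C i x -> C i y -> `|f x - f y| < e) ->
  forall x y, A x -> A y -> `|f x - f y| <= n%:R * e.
Proof.
move=> cA cf AC Ce x y Ax Ay.
wlog xy : x y Ax Ay / f x <= f y.
  by move=> G; have [/G|/ltW/G] := leP (f x) (f y); [|rewrite distrC]; exact.
rewrite distrC ger0_norm ?subr_ge0// leNgt; apply/negP => ne.
have e0 : 0 < e.
  have [i _ Cix] := AC _ Ax.
  by have := Ce i x x Ax Ax Cix Cix; rewrite subrr normr0.
have fA : is_interval (f @` A).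
  apply/connected_intervalP/connected_continuous_connected => //.
  exact: continuous_subspaceT.
have pt (k : 'I_n.+1) : exists a : T * 'I_n,
    [/\ A a.1, C a.2 a.1 & f a.1 = f x + k%:R * e].
  have [] := fA (f x) (f y) _ _ (f x + k%:R * e); [by exists x|by exists y| |].
    rewrite lerDl mulr_ge0 ?ler0n ?(ltW e0)//=.
    rewrite -lerBrDl (le_trans _ (ltW ne))// ler_pM2r// ler_nat.
    by rewrite -ltnS ltn_ord.
  by move=> a Aa fa; have [i _ Cia] := AC _ Aa; exists (a, i).
have [g gP] := choice pt.
have : ~~ injectiveb (fun k => (g k).2).
  by apply/injectiveP => /leq_card; rewrite !card_ord ltnn.
case/injectivePn => k [l kl gkl].
have [Ak Ck fk] := gP k; have [Al Cl fl] := gP l.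
have := Ce (g k).2 _ _ Ak Al Ck; rewrite {1}gkl => /(_ Cl).
rewrite fk fl opprD addrACA subrr add0r -mulrBl normrM (gtr0_norm e0).
rewrite ltNge -{1}[e]mul1r ler_pM2r// => /negP; apply.
rewrite !pmulrn -intrB -intr_norm ler1z -gtz0_ge1 normr_gt0 subr_eq0.
by rewrite eqz_nat.
Qed.

(** A connected set of diameter below all the moduli of uniform continuity for
    e / (n + 1) falls under [pieces_variation]. This is how uniform continuity
    on the pieces reaches pairs of points in different pieces. *)
Lemma small_connected_oscillation (R : realType) (X : metricType R)
    n (C : 'I_n -> set X) (f : X -> R) :
  continuous f -> \bigcup_i C i = [set: X] ->
  (forall i, unif_continuous (sigL (C i) f)) ->
  forall e : R, 0 < e -> exists2 d : R, 0 < d &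
    forall A, connected A -> (diameter A < d%:E)%E ->
      forall x y, A x -> A y -> `|f x - f y| < e.
Proof.
move=> cf CT ucf e e0; pose e' := e / n.+1%:R.
have e'0 : 0 < e' by rewrite divr_gt0.
have dP i : exists d : R, 0 < d /\
    forall x y, C i x -> C i y -> mdist x y < d -> `|f x - f y| < e'.
  have /unif_continuous_sigL_mdistP/(_ e' e'0)[d d0 dP] := ucf i.
  by exists d.
have [d {}dP] := choice dP.
exists (\big[Order.min/1]_i d i).
  by apply: lt_bigmin => // i _; have [] := dP i.
move=> A cA Ad x y Ax Ay.
have /le_lt_trans -> // : `|f x - f y| <= n%:R * e'.
  apply: (pieces_variation (C := C) cA cf _ _ Ax Ay); first by rewrite CT.
  move=> i u v Au Av Ciu Civ; apply: (dP i).2 => //.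
  apply: lt_le_trans (diameter_lt_mdist Ad Au Av) _.
  exact: bigmin_le.
by rewrite /e' mulrA ltr_pdivrMr// mulrC ltr_pM2l// ltr_nat.
Qed.

(** Restriction gives the other implication in the definition. *)
Lemma straight_of_unif_continuous (R : realType) (X : metricType R) :
  (forall n (C : 'I_n -> set X) (f : X -> R), continuous f ->
    \bigcup_i C i = [set: X] -> (forall i, unif_continuous (sigL (C i) f)) ->
    unif_continuous f) ->
  straight X.
Proof.
move=> H n C _ CT f cf; split; last exact: H.
move=> /unif_continuous_mdistP ucf i; apply/unif_continuous_sigL_mdistP => e.
by move=> /ucf[d d0 dP]; exists d => // x y _ _; exact: dP.
Qed.

Lemma ULC_straight (R : realType) (X : metricType R) : ULC X -> straight X.
Proof.
move=> ulc; apply: straight_of_unif_continuous => n C f cf CT ucf.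
apply/unif_continuous_mdistP => e e0.
have [d d0 dP] := small_connected_oscillation cf CT ucf e0.
have [d' d'0 d'P] := ulc d d0; exists d' => // x y /d'P[A [Ax Ay cA Ad]].
exact: dP cA Ad _ _ Ax Ay.
Qed.

(** * Distance and connectedness in countable products *)

Section countable_products.
Context (R : realType) (X : nat -> metric1Type R).
Implicit Types x y z : countable_prod X.

Let term x y n : R := mdist (x n) (y n) / 2 ^+ n.+1.

Let partial_sum_le x y m : series (term x y) m <= mdist x y.
Proof.
apply: nondecreasing_cvgn_le; last exact: is_cvg_countable_prod_dist.
by apply: nondecreasing_series => k _ _; rewrite divr_ge0 ?mdist_ge0.
Qed.

Lemma mdist_coord x y n : mdist (x n) (y n) <= 2 ^+ n.+1 * mdist x y.
Proof.
rewrite mulrC -ler_pdivrMr ?exprn_gt0//.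
apply: le_trans (partial_sum_le x y n.+1).
rewrite /series/= big_nat_recr//= lerDr sumr_ge0// => k _.
by rewrite divr_ge0 ?mdist_ge0.
Qed.

Lemma mdist_countable_prod_le x y (e : R) N : 0 <= e ->
  (forall n, (n < N)%N -> mdist (x n) (y n) <= e) ->
  mdist x y <= e + 2 ^- N.
Proof.
move=> e0 xye.
(* The first m weights sum to 1 - 2 ^- m; beyond N each factor adds at most its
   weight, because distances are bounded by 1. *)
have head m : (m <= N)%N -> series (term x y) m <= e * (1 - 2 ^- m).
  elim: m => [_|m IH mN].
    by rewrite /series/= big_geq// expr0 invr1 subrr mulr0.
  rewrite seriesSr.
  have -> : e * (1 - 2 ^- m.+1) = e * (1 - 2 ^- m) + e / 2 ^+ m.+1.
    by rewrite exprS invfM; set u := 2 ^- m; lra.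
  by rewrite lerD ?IH 1?ltnW// ler_pM2r ?invr_gt0 ?exprn_gt0// xye.
have tail k : series (term x y) (N + k)%N <= e + (2 ^- N - 2 ^- (N + k)).
  elim: k => [|k IH].
    rewrite addn0 subrr addr0; apply: le_trans (head N (leqnn N)) _.
    by rewrite ler_piMr// gerBl invr_ge0 exprn_ge0.
  rewrite addnS seriesSr.
  have -> : e + (2 ^- N - 2 ^- (N + k).+1) =
      e + (2 ^- N - 2 ^- (N + k)) + 2 ^- (N + k).+1.
    by rewrite [2 ^+ (N + k).+1]exprS invfM; set u := 2 ^- (N + k); lra.
  by rewrite lerD// ler_piMl ?mdist_le1// invr_ge0 exprn_ge0.
apply: limr_le; first exact: is_cvg_countable_prod_dist.
exists N => // m /= Nm; rewrite -(subnKC Nm); apply: le_trans (tail _) _.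
by rewrite lerD2l gerBl invr_ge0 exprn_ge0.
Qed.

(** Basic neighborhoods in the product, uniformly in the centre. *)
Lemma mdist_countable_prod_lt (eps : R) : 0 < eps ->
  exists N, exists2 e : R, 0 < e & forall x y,
    (forall n, (n < N)%N -> mdist (x n) (y n) < e) -> mdist x y < eps.
Proof.
move=> eps0; have eps20 : 0 < eps / 2 by rewrite divr_gt0.
have [N _ /(_ N (leqnn N)) NP] := near_infty_natSinv_expn_lt (PosNum eps20).
exists N; exists (eps / 2) => // x y xye.
have /le_lt_trans -> // := mdist_countable_prod_le (ltW eps20)
  (fun n nN => ltW (xye n nN)).
by move: NP; rewrite /= div1r => NP; rewrite [ltRHS](splitr eps) ltrD2l.
Qed.

Lemma coord_continuous n : continuous (fun z : countable_prod X => z n).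
Proof.
apply/continuous_mdistP => x e e0.
exists (e / 2 ^+ n.+1) => [|y]; first by rewrite divr_gt0 ?exprn_gt0.
rewrite ltr_pdivlMr ?exprn_gt0// mulrC; apply: le_lt_trans.
exact: mdist_coord.
Qed.

Lemma dfwith_countable_prod_continuous z n :
  continuous (dfwith z n : X n -> countable_prod X).
Proof.
apply/continuous_mdistP => a e e0.
have [N [d d0 dP]] := mdist_countable_prod_lt e0.
exists d => // b ab; apply: dP => k _.
have [<-|nk] := eqVneq n k; first by rewrite !dfwithin.
by rewrite !dfwithout// mdistxx.
Qed.

(** Points of the box that differ from a fixed x in the first N coordinates only
    form a connected set, by attaching to the set for N - 1 a copy of the
    factor N - 1 at each of its points. The union of these sets over N is dense
    in the box. *)
Lemma connected_box (A : forall n, set (X n)) : (forall n, connected (A n)) ->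
  connected [set z : countable_prod X | forall n, A n (z n)].
Proof.
move=> cA; set B := [set z | _].
have [->|/set0P[x Bx]] := eqVneq B set0; first exact: connected0.
pose D N := [set z | B z /\ forall n, (N <= n)%N -> z n = x n].
have Dx N : D N x by [].
have cD N : connected (D N).
  elim: N => [|N IH].
    rewrite (_ : D 0%N = [set x]); first exact: connected1.
    apply/seteqP; split=> [z [_ zx]|_ ->//].
    by apply: functional_extensionality_dep => n; exact: zx.
  pose L z := D N `|` (dfwith z N @` A N : set (countable_prod X)).
  have -> : D N.+1 = \bigcup_(z in D N) L z.
    apply/seteqP; split=> [z [Bz zx]|z [w [Bw wx]] []].
    - exists (dfwith z N (x N)); last right.
        split=> n; case: dfwithP => // k Nk kN; apply: zx.
        by rewrite ltn_neqAle Nk.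
      exists (z N) => //; apply: functional_extensionality_dep => n.
      case: dfwithP => // k Nk; by rewrite dfwithout.
    - by move=> [Bz zx]; split=> // n /ltnW; exact: zx.
    - move=> [a Aa <-]; split=> n; first by case: dfwithP.
      by move=> Nn; rewrite dfwithout ?(ltn_eqF Nn)//; apply: wx; exact: ltnW.
  apply: bigcup_connected => [|z Dz]; first by exists x => z _; left.
  apply: connectedU => //.
    exists z; split=> //; exists (z N); first exact: Dz.1.
    apply: functional_extensionality_dep => n.
    by case: dfwithP.
  apply: connected_continuous_connected (cA N) _.
  apply: continuous_subspaceT; exact: dfwith_countable_prod_continuous.
apply: (@connected_dense _ (\bigcup_N D N)).
- by apply: bigcup_connected => //; exists x => N _.
- by move=> z [N _ []].
move=> z Bz U /nbhs_mdist[e e0 eU].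
have [N [d d0 dP]] := mdist_countable_prod_lt e0.
exists (fun n => if (n < N)%N then z n else x n); split.
  exists N => //; split=> n; first by case: ifP.
  by rewrite leqNgt => /negbTE ->.
by apply: eU; apply: dP => n ->; rewrite mdistxx.
Qed.

End countable_products.

(** * Uniform local connectedness of powers *)

Section omega_powers.
Context (R : realType) (X : metric1Type R).

Lemma ULC_connected_component : ULC X -> exists2 d : R, 0 < d &
  forall x y, mdist x y < d -> connected_component [set: X] x y.
Proof.
move=> /(_ 1 ltr01)[d d0 dP]; exists d => // x y /dP[A [Ax Ay cA _]].
by exists A.
Qed.

(** The box of small connected sets in the first N coordinates and of arbitrary
    connected sets in the others. Asking only for common components in the
    remaining coordinates covers both cases of the theorem: a connected X, and
    points that are uniformly close in all coordinates. *)
Lemma omega_small_connected : ULC X -> forall eps : R, 0 < eps ->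
  exists N, exists2 d : R, 0 < d & forall x y : omega_power X,
    (forall n, connected_component [set: X] (x n) (y n)) ->
    (forall n, (n < N)%N -> mdist (x n) (y n) < d) ->
    exists A, [/\ A x, A y, connected A & (diameter A < eps%:E)%E].
Proof.
move=> ulc eps eps0; have eps20 : 0 < eps / 2 by rewrite divr_gt0.
have [N [e e0 eP]] := mdist_countable_prod_lt (fun=> X) eps20.
have [d d0 dP] := ulc e e0.
exists N, d => // x y xy xyd.
have /choice[A AP] n : exists A : set X, [/\ A (x n), A (y n), connected A &
    (n < N)%N -> (diameter A < e%:E)%E].
  have [nN|_] := boolP (n < N)%N.
    by have [A [Ax Ay cA Ae]] := dP _ _ (xyd n nN); exists A.
  by have [A [Ax _ cA] Ay] := xy n; exists A.
exists [set z | forall n, A n (z n)]; split.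
- by move=> n; have [] := AP n.
- by move=> n; have [] := AP n.
- by apply: connected_box => n; have [] := AP n.
have /le_lt_trans -> // : (diameter [set z : omega_power X |
    forall n, A n (z n)] <= (eps / 2)%:E)%E.
  apply: mdist_le_diameter => u v Au Av; apply/ltW/eP => n nN.
  have [_ _ _ /(_ nN) Ae] := AP n; exact: diameter_lt_mdist Ae (Au n) (Av n).
by rewrite lte_fin gtr_pMr// invf_lt1// ltr1n.
Qed.

Lemma ULC_omega_power :
  ULC X -> connected [set: X] -> ULC (omega_power X).
Proof.
move=> ulc cX eps /(omega_small_connected ulc)[N [d d0 dP]].
exists (d / 2 ^+ N) => [|x y]; first by rewrite divr_gt0 ?exprn_gt0.
rewrite ltr_pdivlMr ?exprn_gt0// mulrC => xy.
apply: dP => n; first by rewrite connected_component_id.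
move=> nN; apply: le_lt_trans (mdist_coord x y n) _; apply: le_lt_trans xy.
by rewrite ler_wpM2r ?mdist_ge0// ler_eXn2l ?ltr1n.
Qed.

Lemma connected_ULC_omega_power :
  ULC (omega_power X) -> connected [set: X].
Proof.
move=> /(_ 1 ltr01)[d d0 dP]; apply: contrapT => /connectedPn[E [E0 ET sE]].
have [a Ea] := E0 false; have [b Eb] := E0 true.
have [N [e e0 eP]] := mdist_countable_prod_lt (fun=> X) d0.
pose y : omega_power X := dfwith (fun=> a) N b.
have [|A [Ax Ay cA _]] := dP (fun=> a) y.
  by apply: eP => n nN; rewrite /y dfwithout ?mdistxx// gtn_eqF.
have cA' : connected ((fun z : omega_power X => z N) @` A).
  apply: connected_continuous_connected cA _.
  by apply: continuous_subspaceT; exact: coord_continuous.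
have disj := separated_disjoint sE.
have A'a : ((fun z : omega_power X => z N) @` A) a by exists (fun=> a).
have A'b : ((fun z : omega_power X => z N) @` A) b.
  by exists y => //; rewrite /y dfwithin.
have [||] := connected_subset sE _ cA'; first by rewrite -ET.
- by move=> /(_ _ A'b) Eb'; have : set0 b by rewrite -disj.
- by move=> /(_ _ A'a) Ea'; have : set0 a by rewrite -disj.
Qed.

End omega_powers.

(** * Powers of totally bounded spaces *)

(** Heine-Cantor with only one of the two points in the compact set. *)
Lemma compact_modulus (R : realType) (X : metricType R) (K : set X)
    (f : X -> R) : compact K -> continuous f -> forall e : R, 0 < e ->
  exists2 d : R, 0 < d &
    forall x y, K x -> mdist x y < d -> `|f x - f y| < e.
Proof.
move=> cK cf e e0; have e20 : 0 < e / 2 by rewrite divr_gt0.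
have /compact_near_coveringP/(_ R 0^'+ (fun d x => forall y, mdist x y < d ->
  `|f x - f y| < e)) := cK.
case=> [x Kx|d /= d0 dP].
  have /nbhs_mdist[r r0 rP] := cf x _ (nbhsx_ballx (f x) _ e20).
  have r20 : 0 < r / 2 by rewrite divr_gt0.
  exists ([set y | mdist x y < r / 2], [set d | d < r / 2]).
    split=> /=; first by apply/nbhs_mdist; exists (r / 2).
    exact: nbhs_right_lt.
  move=> [u d] /= [xu dr] y uy; rewrite (splitr e).
  rewrite -(subrK (f x) (f u)) -addrA (le_lt_trans (ler_normD _ _))// ltrD//.
    rewrite distrC; apply: rP; apply: lt_trans xu _.
    by rewrite gtr_pMr// invf_lt1// ltr1n.
  apply: rP; apply: le_lt_trans (metric_triangle x u y) _.
  by rewrite (splitr r) ltrD// (lt_trans uy).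
by exists (d / 2) => [|x y Kx]; [rewrite divr_gt0|apply: dP => //=;
  rewrite ?sub0r ?normrN ?gtr0_norm ?divr_gt0 ?gtr_pMr ?invf_lt1 ?ltr1n].
Qed.

(** Tychonoff, transported along the identity from the product topology to the
    metric topology. *)
Lemma compact_box (R : realType) (X : nat -> metric1Type R)
    (K : forall n, set (X n)) : (forall n, compact (K n)) ->
  compact [set z : countable_prod X | forall n, K n (z n)].
Proof.
move=> /tychonoff cK.
pose g (z : prod_topology X) : countable_prod X := z.
have cg : continuous g.
  move=> z A /nbhs_mdist[e e0 eA].
  have [N [d d0 dP]] := mdist_countable_prod_lt X e0.
  have : \forall w \near z, forall n : 'I_N,
      ball (z n) d ((w : prod_topology X) n).
    apply: (@filter_forall _ _ (fun (n : 'I_N) (w : prod_topology X) =>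
      ball (z n) d (w n)) (nbhs z)) => n.
    exact: (@proj_continuous _ X n z _ (nbhsx_ballx (z n) _ d0)).
  apply: filterS => w zw; apply/eA/dP => n nN.
  by have := zw (Ordinal nN); rewrite ballEmdist.
have := continuous_compact (continuous_subspaceT cg) cK.
by congr compact; apply/seteqP; split=> [_ [z Kz <-]//|z Kz]; exists z.
Qed.

(** Total boundedness replaces connectedness through the compact set F^omega:
    a far coordinate of y may lie in another component than that of x, and only
    continuity near F^omega controls this change. *)
Lemma ULC_totally_bounded_straight_omega_power (R : realType)
    (X : metric1Type R) :
  ULC X -> totally_bounded X -> straight (omega_power X).
Proof.
move=> ulc tbX; apply: straight_of_unif_continuous => n C f cf CT ucf.
apply/unif_continuous_mdistP => eps eps0.
have e0 : 0 < eps / 3 by rewrite divr_gt0.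
have [d d0 dP] := small_connected_oscillation cf CT ucf e0.
have [M [d1 d10 d1P]] := omega_small_connected ulc d0.
have [d2 d20 d2P] := ULC_connected_component ulc.
pose t := Num.min d1 d2; have t0 : 0 < t by rewrite lt_min d10.
have close (x y : omega_power X) : (forall n, mdist (x n) (y n) < t) ->
    `|f x - f y| < eps / 3.
  move=> xy; have [||A [Ax Ay cA Ad]] := d1P x y.
  - by move=> k; apply: d2P; rewrite (lt_le_trans (xy k))// ge_min lexx orbT.
  - by move=> k _; rewrite (lt_le_trans (xy k))// ge_min lexx.
  exact: dP Ad _ _ Ax Ay.
have t20 : 0 < t / 2 by rewrite divr_gt0.
have [F finF XF] := tbX _ t20.
have /choice[r rP] x : exists p, F p /\ mdist x p < t / 2.
  have : [set: X] x by []; rewrite XF => -[p Fp].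
  by rewrite ballEmdist/= metric_sym => xp; exists p.
have cK := @compact_box R (fun=> X) (fun=> F) (fun=> finite_compact finF).
have [d3 d30 d3P] := compact_modulus cK cf e0.
have [N [d4 d40 d4P]] := mdist_countable_prod_lt (fun=> X) d30.
exists (t / 2 / 2 ^+ N) => [|x y]; first by rewrite !divr_gt0 ?exprn_gt0.
rewrite ltr_pdivlMr ?exprn_gt0// mulrC => xy.
have xyn k : (k < N)%N -> mdist (x k) (y k) < t / 2.
  move=> kN; apply: le_lt_trans (mdist_coord x y k) _; apply: le_lt_trans xy.
  by rewrite ler_wpM2r ?mdist_ge0// ler_eXn2l ?ltr1n.
(* x and x' differ by less than t in every coordinate, and so do y' and y; x'
   lies in the compact power of F, and y' agrees with it up to N. *)
pose x' : omega_power X := fun k => r (x k).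
pose y' : omega_power X := fun k => if (k < N)%N then r (x k) else y k.
have xx' : `|f x - f x'| < eps / 3.
  apply: close => k; apply: lt_trans (rP _).2 _.
  by rewrite gtr_pMr// invf_lt1// ltr1n.
have x'y' : `|f x' - f y'| < eps / 3.
  apply: d3P => [k|]; first exact: (rP _).1.
  by apply: d4P => k kN; rewrite /x' /y' kN mdistxx.
have y'y : `|f y' - f y| < eps / 3.
  apply: close => k; rewrite /y'; case: ifPn => [kN|_]; last by rewrite mdistxx.
  apply: le_lt_trans (metric_triangle _ (x k) _) _.
  by rewrite (splitr t) ltrD ?xyn// metric_sym; exact: (rP _).2.
rewrite -(subrKA (f x')) -[X in _ + X](subrKA (f y')).
rewrite (le_lt_trans (ler_normD _ _))//.
have := ler_normD (f x' - f y') (f y' - f y); lra.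
Qed.

(** * Failure of straightness *)

(** No finite set is an e-net, so each finite prefix of the sequence leaves a
    point at distance at least e from it. *)
Lemma separated_sequence (R : realType) (X : metricType R) :
  ~ totally_bounded X -> exists2 e : R, 0 < e &
    exists u : nat -> X, forall m n, m != n -> e <= mdist (u m) (u n).
Proof.
move=> /existsNP[e /not_implyP[e0 eX]]; exists e => //.
have /choice[next nextP] (s : seq X) :
    exists p, forall q, q \in s -> e <= mdist q p.
  apply: contrapT => sX; apply: eX; exists [set` s] => //.
  apply/seteqP; split=> // p _; apply: contrapT => ps; apply: sX; exists p.
  move=> q qs; rewrite leNgt; apply/negP => qp; apply: ps.
  by exists q => //; rewrite ballEmdist.
pose prefix n := iter n (fun s => next s :: s) [::].
exists (next \o prefix).
suff lt m n : (m < n)%N -> e <= mdist (next (prefix m)) (next (prefix n)).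
  move=> m n; rewrite neq_ltn => /orP[] /lt //; by rewrite metric_sym.
move=> mn; apply: nextP; elim: n mn => // n IH.
by rewrite ltnS leq_eqVlt /= inE => /orP[/eqP->|/IH ->]; rewrite ?eqxx ?orbT.
Qed.

Section bump.
Context (R : realType) (X : metricType R) (u : nat -> X) (r : R).

(** Written with the distance to the range of u rather than as a sum of bumps
    around its points, so that it is 1-Lipschitz as the distance is. *)
Definition bump (x : X) : R :=
  Num.max 0 (r - inf (range (fun n => mdist (u n) x))).

Let dists x := range (fun n => mdist (u n) x).

Let dists_lb x : has_lbound (dists x).
Proof. by exists 0 => _ [n _ <-]; exact: mdist_ge0. Qed.

Let dists_neq0 x : dists x !=set0.
Proof. by exists (mdist (u 0%N) x), 0%N. Qed.

Lemma bump_lipschitz x y : `|bump x - bump y| <= mdist x y.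
Proof.
have le_inf a b : inf (dists a) - mdist a b <= inf (dists b).
  apply: lb_le_inf => // _ [n _ <-]; rewrite lerBlDr (metric_sym a).
  apply: le_trans (metric_triangle _ b _).
  by apply: ge_inf => //; exists n.
have := le_inf x y; have := le_inf y x; rewrite (metric_sym y x) /bump.
rewrite -/(dists x) -/(dists y); move: (inf _) (inf _) => p q.
rewrite ler_norml /Num.max; case: ifP; case: ifP; have := mdist_ge0 x y; lra.
Qed.

Lemma bump_eq0 x : (forall n, r <= mdist (u n) x) -> bump x = 0.
Proof.
move=> rx; apply/max_l; rewrite subr_le0.
by apply: lb_le_inf (dists_neq0 x) _ => _ [n _ <-]; exact: rx.
Qed.

Lemma bump_seq n : 0 <= r -> bump (u n) = r.
Proof.
move=> r0; rewrite /bump.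
suff -> : inf (dists (u n)) = 0 by rewrite subr0; exact/max_r.
apply/eqP; rewrite eq_le; apply/andP; split.
  by apply: (ge_inf (dists_lb _)); exists n; rewrite ?mdistxx.
by apply: lb_le_inf (dists_neq0 _) _ => _ [m _ <-]; exact: mdist_ge0.
Qed.

End bump.

(** Coordinate 0 selects, through the bump around u_n, the coordinate n + 1 that
    is tested for membership in E false or E true. The two conditions define
    closed sets covering the power, as the balls around the u_n are disjoint,
    and the bump function vanishes where both hold. *)
Lemma straight_omega_power_connected (R : realType) (X : metric1Type R) :
  straight (omega_power X) -> ~ totally_bounded X -> connected [set: X].
Proof.
move=> stX /separated_sequence[e e0 [u ue]].
apply: contrapT => /connectedPn[E [E0 ET sE]].
have [a Ea] := E0 false; have [b Eb] := E0 true.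
have Ecl c : closed (E c).
  have EC : ~` E false = E true.
    rewrite -[LHS]setIT ET setIUr setICl set0U; apply/setIidr => x Et Ef.
    by have : set0 x by rewrite -(separated_disjoint sE).
  have /clopen_separatedP[oE cE] : separated (E false) (~` E false).
    by rewrite EC.
  by case: c => //; rewrite -EC; exact: open_closedC.
pose r := e / 2; have r0 : 0 < r by rewrite divr_gt0.
pose C c : set (omega_power X) :=
  [set z | forall n, mdist (u n) (z 0%N) < r -> E c (z n.+1)].
have uniq_near x m n : mdist (u m) x < r -> mdist (u n) x < r -> m = n.
  move=> mx nx; apply: contrapT => /eqP/ue; rewrite leNgt => /negP; apply.
  apply: le_lt_trans (metric_triangle _ x _) _.
  by rewrite (splitr e) ltrD// metric_sym.
have Ccl c : closed (C c).
  move=> z zC n nz; apply: Ecl => A nA.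
  have nA' : nbhs z ((fun w : omega_power X => w n.+1) @^-1` A).
    exact: (@coord_continuous R (fun=> X) n.+1 z).
  have near_u : nbhs z [set w : omega_power X | mdist (u n) (w 0%N) < r].
    have : nbhs (z 0%N) [set y | mdist (u n) y < r].
      apply/nbhs_mdist; exists (r - mdist (u n) (z 0%N)) => [|y zy].
        by rewrite subr_gt0.
      by apply: le_lt_trans (metric_triangle _ (z 0%N) _) _; rewrite -ltrBrDl.
    exact: (@coord_continuous R (fun=> X) 0%N z).
  have [w [Cw [nw Aw]]] := zC _ (filterI near_u nA').
  by exists (w n.+1); split=> //; exact: Cw.
have CT : C false `|` C true = setT.
  apply/seteqP; split=> // z _.
  have [[n nz]|zfar] := pselect (exists n, mdist (u n) (z 0%N) < r); last first.
    by left=> n nz; exfalso; apply: zfar; exists n.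
  have : [set: X] (z n.+1) by []; rewrite ET => -[] Ezn; [left|right] => m mz;
    by rewrite (uniq_near _ _ _ mz nz).
pose h (z : omega_power X) := bump u r (z 0%N).
(* On the intersection of the pieces the bump vanishes, so the two definitions
   of f paste. *)
pose f z := if z \in C true then h z else 0.
have fC1 z : C true z -> f z = h z by move=> Cz; rewrite /f mem_set.
have fC0 z : C false z -> f z = 0.
  move=> C0z; rewrite /f; case: ifPn => // /set_mem C1z.
  apply: bump_eq0 => n; rewrite leNgt; apply/negP => nz.
  have : set0 (z n.+1); last by [].
  by rewrite -(separated_disjoint sE); split; [exact: C0z|exact: C1z].
have hlip x y : `|h x - h y| <= 2 * mdist x y.
  apply: le_trans (bump_lipschitz _ _ _ _) _.
  by have := mdist_coord x y 0%N; rewrite expr1.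
have uch (D : set (omega_power X)) : unif_continuous (sigL D h).
  apply/unif_continuous_sigL_mdistP => d d0.
  exists (d / 2) => [|x y _ _ xy]; first by rewrite divr_gt0.
  by apply: le_lt_trans (hlip x y) _; rewrite mulrC -ltr_pdivlMr.
have ucf (i : 'I_2) : unif_continuous (sigL (C (i == 1%N :> nat)) f).
  apply/unif_continuous_sigL_mdistP => d d0.
  have [_|_] := eqVneq (i : nat) 1%N.
    have /unif_continuous_sigL_mdistP/(_ d d0)[t t0 tP] := uch (C true).
    by exists t => // x y Cx Cy xy; rewrite !fC1//; exact: tP.
  by exists 1 => // x y Cx Cy _; rewrite !fC0// subrr normr0.
have ch : continuous h.
  move=> x A /nbhs_ballP[d /= d0 dA]; apply/nbhs_mdist.
  exists (d / 2) => [|y xy].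
    by rewrite divr_gt0.
  by apply/dA/(le_lt_trans (hlip x y)); rewrite mulrC -ltr_pdivlMr.
have cf : continuous f.
  apply/continuous_subspace_setT; rewrite -CT.
  apply: withinU_continuous => //.
  - apply: (@subspace_eq_continuous _ _ _ (fun=> 0 : R)).
      by move=> z /set_mem Cz; exact/esym/fC0.
    by apply: continuous_subspaceT; exact: cst_continuous.
  - apply: (@subspace_eq_continuous _ _ _ h).
      by move=> z /set_mem Cz; exact/esym/fC1.
    exact: continuous_subspaceT.
have [||_] := stX 2%N (fun i : 'I_2 => C (i == 1%N :> nat)) _ _ f cf.
- by move=> i; exact: Ccl.
- apply/seteqP; split=> // z _; have : setT z by []; rewrite -CT => -[] Cz.
    by exists ord0.
  by exists (lift ord0 ord0).
move=> /(_ ucf)/unif_continuous_mdistP/(_ r r0)[d d0 dP].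
have [N [t t0 tP]] := mdist_countable_prod_lt (fun=> X) d0.
(* z lies in the piece C false and w in C true; they differ only in the
   coordinate N + 1, which weighs less than the modulus d. *)
pose z : omega_power X := fun n => if n is 0%N then u N else a.
pose w : omega_power X := dfwith z N.+1 b.
have zw : mdist z w < d.
  by apply: tP => n nN; rewrite /w dfwithout ?mdistxx// gtn_eqF// ltnW.
have fz : f z = 0 by apply: fC0 => n _.
have fw : f w = r.
  rewrite fC1 => [|n].
    by rewrite /h /w dfwithout//= bump_seq// ltW.
  rewrite {1}/w dfwithout//= => nN.
  have -> : n = N by apply: (uniq_near (u N)) => //; rewrite mdistxx.
  by rewrite /w dfwithin.
by have := dP _ _ zw; rewrite fz fw sub0r normrN gtr0_norm// ltxx.
Qed.

Theorem corollary2 (R : realType) (X : metric1Type R)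
    (X_neq0 : [set: X] !=set0) (X_ULC : ULC X) :
  (ULC (omega_power X) <-> connected [set: X]) /\
  (straight (omega_power X) <-> connected [set: X] \/ totally_bounded X).
Proof.
split; split=> [|].
- exact: connected_ULC_omega_power.
- exact: ULC_omega_power.
- move=> stX; have [tbX|ntbX] := pselect (totally_bounded X); first by right.
  by left; exact: straight_omega_power_connected.
- move=> [cX|]; last exact: ULC_totally_bounded_straight_omega_power.
  exact/ULC_straight/ULC_omega_power.
Qed.
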